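(* Algorithm 1 is a factor-$1.5$ approximation for $1|(1,L_j,1)|\sum C_j$. That is, Algorithm 1 runs in polynomial time, and for every instance with $a_j=b_j=1$ for all jobs $j$ it outputs a feasible schedule whose sum of completion times is at most $1.5$ times the minimum sum of completion times over all feasible schedules.
   Context: Coupled task scheduling on a single machine: each job $j\in\{1,\dots,n\}$ has a first task of processing time $a_j$, a second task of processing time $b_j$, and a delay time $L_j$. A feasible schedule assigns a starting time $S_j\ge 0$ to each job $j$; the first task occupies $[S_j,S_j+a_j]$, the second task occupies $[S_j+a_j+L_j,\,S_j+a_j+L_j+b_j]$ (the delay is exact, no preemption), and no two of the $2n$ tasks overlap (their intervals have disjoint interiors). Other tasks may be processed during the delay of a job. The completion time of $j$ is $C_j=S_j+a_j+L_j+b_j$, and the objective is to minimize $\sum_{j=1}^n C_j$. The notation $1|(1,L_j,1)|\sum C_j$ denotes this problem restricted to instances with $a_j=b_j=1$ for all $j$, where the delay times $L_j$ may differ between jobs. Algorithm 1. Input: an instance with $a_j=a$, $b_j=b$ for all $j$. Step 1: sort the jobs in non-decreasing order of $L_j$ and re-index them in this order. Step 2: for $j=1,\dots,n$ in this order, schedule job $j$ as soon as possible with respect to the partial schedule of jobs $1,\dots,j-1$, i.e. set $S_j:=\min\{t\ge 0:\text{ the machine is idle both in }[t,t+a_j]\text{ and in }[t+a_j+L_j,\,t+a_j+L_j+b_j]\}$ (idle meaning that no already scheduled task overlaps the interior of the interval). *)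

(* Defs.v *)
From HB Require Import structures.
From mathcomp Require Import all_boot all_order all_algebra all_fingroup.
From mathcomp Require Import reals.

Set Implicit Arguments.
Unset Strict Implicit.
Unset Printing Implicit Defensive.

Import Order.TTheory GRing.Theory Num.Theory.
Local Open Scope ring_scope.

(* Instance data are natural numbers, whereas starting times are reals. *)
Record instance (n : nat) := Instance {
  first_len : 'I_n -> nat;
  second_len : 'I_n -> nat;
  delay : 'I_n -> nat }.

Definition equal_len_instance (n a b : nat) (L : 'I_n -> nat) : instance n :=
  Instance (fun=> a) (fun=> b) L.

Section Schedules.
Variables (R : realType) (n : nat) (I : instance n).
Implicit Types (S : 'I_n -> R) (j : 'I_n).

(* Task (j, false) is the first task of job j, task (j, true) the second. *)
Definition task_start S (x : 'I_n * bool) : R :=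
  if x.2 then S x.1 + (first_len I x.1)%:R + (delay I x.1)%:R else S x.1.

Definition task_len (x : 'I_n * bool) : R :=
  (if x.2 then second_len I x.1 else first_len I x.1)%:R.

(* [s, s + p] and [s', s' + p'] have a common interior point. *)
Definition overlap (s p s' p' : R) : Prop :=
  exists x, s < x < s + p /\ s' < x < s' + p'.

Definition feasible S : Prop :=
  (forall j, 0 <= S j) /\
  (forall x y, x != y ->
     ~ overlap (task_start S x) (task_len x) (task_start S y) (task_len y)).

Definition completion S j : R :=
  S j + (first_len I j)%:R + (delay I j)%:R + (second_len I j)%:R.

Definition total_completion S : R := \sum_(j < n) completion S j.

Definition is_min_total_completion (v : R) : Prop :=
  (exists2 S, feasible S & total_completion S = v) /\
  (forall S, feasible S -> v <= total_completion S).

(* The machine is idle in [t, t + p] if only the jobs of D are scheduled. *)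
Definition idle S (D : pred 'I_n) (t p : R) : Prop :=
  forall x, D x.1 -> ~ overlap (task_start S x) (task_len x) t p.

Definition can_start S (D : pred 'I_n) j (t : R) : Prop :=
  [/\ 0 <= t, idle S D t (first_len I j)%:R
    & idle S D (t + (first_len I j)%:R + (delay I j)%:R) (second_len I j)%:R].

Definition is_least (P : R -> Prop) (t : R) : Prop :=
  P t /\ forall u, P u -> t <= u.

(* S is an output of Algorithm 1: s k is the job in position k of the sorted
   order; equal delays may be ordered arbitrarily. *)
Definition algorithm1_output S : Prop :=
  exists s : {perm 'I_n},
    (forall i k : 'I_n, (i <= k)%N -> (delay I (s i) <= delay I (s k))%N) /\
    (forall k : 'I_n,
       is_least (can_start S [pred j | ((s^-1)%g j < k)%N] (s k)) (S (s k))).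

End Schedules.

(* Running time is measured on random access machines under the unit-cost
   criterion.  The only arithmetic operations are addition and truncated
   subtraction, so one step increases the largest bit length by at most a
   constant; hence polynomially many steps is the same as polynomial time on
   Turing machines.  Programs are structured, and a machine has registers,
   addressed by constants only, besides its indirectly addressed memory. *)
Record state := State { register : nat -> nat; memory : nat -> nat }.

Inductive expr :=
| Const of nat
| Reg of nat
| Mem of expr
| Add of expr & expr
| Sub of expr & expr.

Fixpoint eval (st : state) (e : expr) : nat :=
  match e with
  | Const k => k
  | Reg x => register st x
  | Mem e1 => memory st (eval st e1)
  | Add e1 e2 => eval st e1 + eval st e2
  | Sub e1 e2 => eval st e1 - eval st e2
  end%N.

Fixpoint eval_cost (e : expr) : nat :=
  match e with
  | Const _ | Reg _ => 1
  | Mem e1 => (eval_cost e1).+1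
  | Add e1 e2 | Sub e1 e2 => (eval_cost e1 + eval_cost e2).+1
  end%N.

(* The tests of IfLe e1 e2 and WhileLe e1 e2 are e1 <= e2. *)
Inductive com :=
| Skip
| SetReg of nat & expr
| SetMem of expr & expr
| Seq of com & com
| IfLe of expr & expr & com & com
| WhileLe of expr & expr & com.

Definition update (f : nat -> nat) (i v : nat) : nat -> nat :=
  fun k => if k == i then v else f k.

(* exec c st t st': started in st, c halts in st' after t steps. *)
Inductive exec : com -> state -> nat -> state -> Prop :=
| exec_Skip st : exec Skip st 1 st
| exec_SetReg st x e :
    exec (SetReg x e) st (eval_cost e).+1
      (State (update (register st) x (eval st e)) (memory st))
| exec_SetMem st e1 e2 :
    exec (SetMem e1 e2) st (eval_cost e1 + eval_cost e2)%N.+1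
      (State (register st) (update (memory st) (eval st e1) (eval st e2)))
| exec_Seq st1 st2 st3 c1 c2 t1 t2 :
    exec c1 st1 t1 st2 -> exec c2 st2 t2 st3 ->
    exec (Seq c1 c2) st1 (t1 + t2)%N st3
| exec_IfLe_true st st' e1 e2 c1 c2 t :
    (eval st e1 <= eval st e2)%N -> exec c1 st t st' ->
    exec (IfLe e1 e2 c1 c2) st (eval_cost e1 + eval_cost e2 + t)%N.+1 st'
| exec_IfLe_false st st' e1 e2 c1 c2 t :
    (eval st e2 < eval st e1)%N -> exec c2 st t st' ->
    exec (IfLe e1 e2 c1 c2) st (eval_cost e1 + eval_cost e2 + t)%N.+1 st'
| exec_WhileLe_true st1 st2 st3 e1 e2 c t1 t2 :
    (eval st1 e1 <= eval st1 e2)%N -> exec c st1 t1 st2 ->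
    exec (WhileLe e1 e2 c) st2 t2 st3 ->
    exec (WhileLe e1 e2 c) st1 (eval_cost e1 + eval_cost e2 + t1 + t2)%N.+1 st3
| exec_WhileLe_false st e1 e2 c :
    (eval st e2 < eval st e1)%N ->
    exec (WhileLe e1 e2 c) st (eval_cost e1 + eval_cost e2)%N.+1 st.

(* Input: n, a, b in registers 0, 1, 2 and the delay of job j in memory cell j;
   everything else is 0. *)
Definition input_state (n a b : nat) (L : 'I_n -> nat) : state :=
  State (nth 0%N [:: n; a; b])
        (fun i => if insub i is Some j then L j else 0%N).

(* Output: the starting time of job j in memory cell n + j. *)
Definition output_schedule (R : realType) (n : nat) (st : state) : 'I_n -> R :=
  fun j => (memory st (n + j)%N)%:R.

(* Length of the binary representation, with one digit for 0. *)
Definition nbits (x : nat) : nat := (trunc_log 2 x).+1.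

Definition input_size (n a b : nat) (L : 'I_n -> nat) : nat :=
  (nbits n + nbits a + nbits b + \sum_(j < n) nbits (L j))%N.

Definition polytime_algorithm1 (R : realType) : Prop :=
  exists (c : com) (p : {poly nat}),
    forall (n a b : nat) (L : 'I_n -> nat), exists (t : nat) (st : state),
      [/\ exec c (input_state a b L) t st,
          (t <= p.[input_size a b L])%N
        & algorithm1_output (equal_len_instance a b L)
            (@output_schedule R n st)].

(* Main.v *)
Require Import Defs.
From mathcomp Require Import all_boot all_order all_algebra all_fingroup.
From mathcomp Require Import reals.
From mathcomp Require Import boolp zify lra.

Set Implicit Arguments.
Unset Strict Implicit.
Unset Printing Implicit Defensive.

Import Order.TTheory GRing.Theory Num.Theory.
Local Open Scope ring_scope.

(* With unit tasks, rounding all starting times down keeps a schedule feasible,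
   so an optimal schedule exists and may be taken integral.  Algorithm 1 starts
   each job in the first free slot: every job scheduled before started below
   it with a delay that is not larger, so the slot of the second task is free
   as well.  Hence job k starts at time at most 2(k-1) and the total completion
   time is at most n^2 + A, where A is the sum of all L_j + 1.  In a feasible
   integral schedule the 2n tasks occupy distinct slots, so twice the sum of
   the starting times plus A is at least n(2n-1); this gives the factor 3/2.

   For the running time, the starting time of a job is found by moving a
   candidate time to the end of any conflict it meets.  A conflict once passed
   never recurs, and there are at most 4n of them. *)

(** * Approximation factor *)

Lemma overlapP (R : realType) (s p s' p' : R) :
  overlap s p s' p' <-> [/\ 0 < p, 0 < p', s < s' + p' & s' < s + p].
Proof.
split=> [[x [/andP[? ?] /andP[? ?]]]|[p0 p'0 ss' s's]]; first by split; lra.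
(* The midpoint of the intersection of the two intervals is interior to both. *)
exists ((Num.max s s' + Num.min (s + p) (s' + p')) / 2).
rewrite maxEle minEle; case: (lerP s s') => ?; case: (lerP (s + p) (s' + p')) => ?;
  by split; apply/andP; split; lra.
Qed.

Lemma overlap_sym (R : realType) (s p s' p' : R) :
  overlap s p s' p' -> overlap s' p' s p.
Proof. by move=> /overlapP[? ? ? ?]; apply/overlapP. Qed.

(** Induction on a strict upper bound of the entries. If the largest admissible value [m] occurs,
    the other entries are distinct and below [m], so there are at most [m] of them, and removing [m]
    lowers the binomial by exactly their number. *)
Lemma sumn_uniq_ge (s : seq nat) : uniq s -> ('C(size s, 2) <= sumn s)%N.
Proof.
have [m] : exists m, all (ltn^~ m) s.
  exists (\max_(x <- s) x).+1; apply/allP => x xs.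
  by rewrite /= ltnS (big_rem x xs) leq_maxl.
elim: m s => [|m IHm] s.
  by case: s => //= x s; rewrite ltn0.
move=> /allP s_lt s_uniq; have [ms|ms] := boolP (m \in s); last first.
  apply: IHm => //; apply/allP => x xs; have /= x_lt := s_lt x xs.
  by have [xm|/=] := eqVneq x m; [rewrite -xm xs in ms|lia].
have rem_lt : {subset rem m s <= iota 0 m}.
  move=> x; rewrite mem_rem_uniq // mem_iota inE => /andP[xm /s_lt /=]; lia.
rewrite (perm_sumn (perm_to_rem ms)) (perm_size (perm_to_rem ms)) /= binS bin1.
have rem_uniq' := rem_uniq m s_uniq.
rewrite addnC leq_add ?IHm //.
  by have := uniq_leq_size rem_uniq' rem_lt; rewrite size_iota.
by apply/allP => x /rem_lt; rewrite mem_iota.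
Qed.

Section Approximation.
Variables (R : realType) (n : nat).

(** Of two tasks of different jobs, the one scheduled later was placed while the machine was idle
    with respect to the other. Tasks of one job are separated because delays are nonnegative. *)
Lemma algorithm1_feasible (I : instance n) (S : 'I_n -> R) :
  algorithm1_output I S -> feasible I S.
Proof.
move=> [s [_ Smin]].
have start j : can_start I S [pred i | (s^-1 i < s^-1 j)%g%N] j (S j).
  by have [] := Smin (s^-1 j)%g; rewrite permKV.
split=> [j|]; first by have [] := start j.
have lt_disjoint x y : (s^-1 x.1 < s^-1 y.1)%g%N ->
    ~ overlap (task_start I S x) (task_len R I x)
              (task_start I S y) (task_len R I y).
  case: y => y [] /= xy; have [_ first second] := start y;
    [exact: second | exact: first].
have same_disjoint j :
    ~ overlap (task_start I S (j, false)) (task_len R I (j, false))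
              (task_start I S (j, true)) (task_len R I (j, true)).
  move=> /overlapP[_ _ _]; rewrite /task_start /task_len /=.
  by have := ler0n R (delay I j); lra.
move=> [i b] [j c] ij.
have [e|ne] := eqVneq i j.
  subst j; case: b c ij => [] []; rewrite ?eqxx // => _.
  by move=> /overlap_sym; apply: same_disjoint.
have : (s^-1 i)%g != (s^-1 j)%g by apply: contra ne => /eqP/perm_inj/eqP.
rewrite -val_eqE /= neq_ltn => /orP[lt_ij|lt_ji].
  exact: lt_disjoint.
by move=> /overlap_sym; apply: lt_disjoint.
Qed.

Variable L : 'I_n -> nat.
Let I := equal_len_instance 1 1 L.

(** For unit tasks with integral starts, the task [x] fills the unit interval from [slot N x], so
    feasibility amounts to injectivity of [slot N]. *)
Definition slot (N : 'I_n -> nat) (x : 'I_n * bool) : nat :=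
  (N x.1 + (if x.2 then (L x.1).+1 else 0))%N.

Lemma task_start_unit (S : 'I_n -> R) x :
  task_start I S x = S x.1 + (if x.2 then (L x.1).+1 else 0)%N%:R.
Proof.
by case: x => j []; rewrite /task_start /= ?addr0 // -addrA -natrD add1n.
Qed.

Lemma task_len_unit x : task_len R I x = 1.
Proof. by case: x => j []. Qed.

Lemma overlap1P (s s' : R) : overlap s 1 s' 1 <-> (s < s' + 1) && (s' < s + 1).
Proof.
by split=> [/overlapP[_ _ -> ->] //|/andP[? ?]]; apply/overlapP; split=> //; lra.
Qed.

Lemma total_completion_slot (S : 'I_n -> R) :
  total_completion I S = \sum_(j < n) S j + (\sum_(j < n) (L j).+2)%:R.
Proof.
rewrite natr_sum -big_split; apply: eq_bigr => j _ /=.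
by rewrite /completion /= -[(L j).+2]addn2 natrD; lra.
Qed.

Lemma feasible_slot (N : 'I_n -> nat) :
  injective (slot N) -> feasible I (fun j => (N j)%:R : R).
Proof.
move=> injN; split=> [j|x y]; first exact: ler0n.
move/eqP=> xy; rewrite !task_len_unit !task_start_unit -!natrD => /overlap1P.
rewrite !natr1 !ltr_nat => xy'; apply/xy/injN.
rewrite /slot; lia.
Qed.

(** Delays are integral, so rounding down the start of a job rounds down both of its tasks. Two
    tasks rounded to the same slot start less than one unit apart and hence overlap. *)
Lemma slot_trunc_inj (S : 'I_n -> R) :
  feasible I S -> injective (slot (fun j => Num.truncn (S j))).
Proof.
move=> [S0 Sdisj] x y xy; apply/eqP/negP => /negP/Sdisj; apply.
rewrite !task_len_unit !task_start_unit; apply/overlap1P.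
have := congr1 (fun k => k%:R : R) xy; rewrite /slot !natrD.
have /andP[] := truncn_itv (S0 x.1); have /andP[] := truncn_itv (S0 y.1).
rewrite -!natr1 => ? ? ? ? ?; apply/andP; split; lra.
Qed.

Lemma slot_sum_ge (N : 'I_n -> nat) : injective (slot N) ->
  (n * n.*2 <= \sum_(j < n) ((N j).*2 + (L j).+2))%N.
Proof.
move=> injN; pose xs := [seq slot N x | x <- enum {: 'I_n * bool}].
have xs_uniq : uniq xs by rewrite map_inj_uniq // enum_uniq.
have := sumn_uniq_ge xs_uniq.
rewrite size_map -cardE card_prod card_ord card_bool sumnE big_map big_enum /=.
rewrite muln2 bin2 -doubleMl doubleK => xs_ge.
(* The slots alone give [n * (2n - 1)], with [L j + 1] per job. One more unit per job on both sides
   produces [L j + 2], the constant part of a completion time. *)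
have -> : (n * n.*2 = n * n.*2.-1 + \sum_(j < n) 1)%N.
  by rewrite sum1_card card_ord addnC -mulnS; case: (n).
apply: leq_trans (leq_add xs_ge (leqnn _)) _.
rewrite -(pair_bigA _ (fun j b => slot N (j, b))) -big_split /=.
apply/leq_sum => j _; rewrite big_bool /slot /=; lia.
Qed.

(** The sums of integral starting times are natural numbers and so have a minimum; rounding down any
    real schedule yields an integral one that is no worse. *)
Lemma unit_opt_exists (S : 'I_n -> R) : feasible I S ->
  exists2 N : 'I_n -> nat, injective (slot N) &
    is_min_total_completion I (total_completion I (fun j => (N j)%:R : R)).
Proof.
move=> Sfeas.
pose P v := `[< exists2 N, injective (slot N) & \sum_(j < n) N j = v >]%N.
have /ex_minnP[v /asboolP[N Ninj Nv] vmin] : exists v, P v.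
  by exists (\sum_j Num.truncn (S j))%N; apply/asboolP; eexists;
     first exact: slot_trunc_inj Sfeas.
exists N => //; split; first by exists (fun j => (N j)%:R); first exact: feasible_slot.
move=> S' S'feas; rewrite !total_completion_slot lerD2r.
apply: (@le_trans _ _ (\sum_(j < n) (Num.truncn (S' j))%:R)).
  rewrite -!natr_sum ler_nat Nv; apply: vmin; apply/asboolP.
  by eexists; first exact: slot_trunc_inj S'feas.
by apply: ler_sum => j _; rewrite truncn_le; case: S'feas => ->.
Qed.

(* The first free slot [t] exceeds every earlier start, whereas a task blocking
   the second task of a job started at [t] belongs to a job started at [t] or
   later, since the delays are sorted. *)
Lemma algorithm1_unit_start (S : 'I_n -> R) (s : {perm 'I_n}) :
  (forall i k : 'I_n, (i <= k)%N -> (L (s i) <= L (s k))%N) ->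
  (forall k : 'I_n,
     is_least (can_start I S [pred j | ((s^-1)%g j < k)%N] (s k)) (S (s k))) ->
  forall k : 'I_n, exists m : nat, [/\ S (s k) = m%:R, (m <= k.*2)%N &
    forall v, (v < m)%N -> exists2 x : 'I_n * bool,
      ((s^-1)%g x.1 < k)%N & task_start I S x = v%:R].
Proof.
move=> s_sorted S_least [k kn]; elim/ltn_ind: k kn => k IHk kn.
set ko := Ordinal kn; pose D := [pred j | ((s^-1)%g j < ko)%N].
pose f x := Num.truncn (task_start I S x).
have Dnat x : D x.1 -> task_start I S x = (f x)%:R.
  rewrite /f task_start_unit /= => Dx.
  have [m [+ _ _]] := IHk _ Dx (ltn_ord _).
  have -> : Ordinal (ltn_ord ((s^-1)%g x.1)) = (s^-1)%g x.1 by apply/val_inj.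
  by rewrite permKV => ->; rewrite -natrD natrK.
(* [O] lists the slots taken by the [k] earlier jobs, at most [2k] of them. The start will be the
   least [t] outside [O]; all slots below [t] lie in [O], whence [t <= 2k]. *)
pose O := [seq f (s i, b) | i <- pmap insub (iota 0 k), b <- [:: false; true]].
have sizeO : (size O <= k.*2)%N.
  rewrite size_allpairs muln2 leq_double size_pmap.
  by rewrite (leq_trans (count_size _ _)) ?size_iota.
have memO v : reflect (exists2 x, D x.1 & f x = v) (v \in O).
  apply: (iffP allpairsP) => [[[i b] [/= ik _ ->]]|[[j b] /= Dj <-]].
    by exists (s i, b); rewrite //= permK; move: ik; rewrite mem_pmap_sub mem_iota.
  exists ((s^-1)%g j, b); rewrite /= permKV; split=> //; last by case: (b).
  by rewrite mem_pmap_sub mem_iota.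
have exfree : exists t, t \notin O.
  exists (\max_(v <- O) v).+1; apply/negP => vO.
  by have := @leq_bigmax_seq _ O xpredT id _ vO isT; rewrite ltnn.
case: (ex_minnP exfree) => t tO tmin.
have below v : (v < t)%N -> v \in O.
  by move=> vt; apply: contraLR vt => /tmin; rewrite -leqNgt.
have occ v : (v < t)%N -> exists2 x, D x.1 & task_start I S x = v%:R.
  by move=> /below/memO[x Dx <-]; exists x; rewrite ?Dnat.
exists t; split => //; last first.
  apply: leq_trans sizeO; rewrite -(size_iota 0 t).
  by apply: uniq_leq_size (iota_uniq _ _) _ => v; rewrite mem_iota => /below.
have free x : D x.1 -> f x <> t.
  by move=> Dx fxt; move/negP: tO; apply; apply/memO; exists x.
have [[S0 first _] Smin] := S_least ko.
apply/eqP; rewrite eq_le; apply/andP; split.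
  apply: Smin; split; first exact: ler0n.
    move=> x Dx; rewrite task_len_unit Dnat // => /overlap1P.
    rewrite !natr1 !ltr_nat => /andP[? ?]; apply: (free x Dx); lia.
  move=> x Dx; rewrite task_len_unit Dnat //= -!natrD => /overlap1P.
  rewrite !natr1 !ltr_nat => /andP[? ?].
  have [m [Sm _ m_occ]] := IHk _ Dx (ltn_ord _).
  have xpos : Ordinal (ltn_ord ((s^-1)%g x.1)) = (s^-1)%g x.1 by apply/val_inj.
  rewrite xpos permKV in Sm m_occ.
  (* The earlier job starts at [m], which differs from the free slot [t]; it cannot exceed [t]
     either, as every slot below [m] was already taken when that job was placed. *)
  have mt : (m < t)%N.
    rewrite ltn_neqAle; apply/andP; split.
      apply/eqP => mt; apply: (free (x.1, false) Dx).
      by rewrite /f /task_start /= Sm natrK.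
    rewrite leqNgt; apply/negP => /m_occ[y yx ty]; apply: (free y).
      exact: ltn_trans yx Dx.
    by rewrite /f ty natrK.
  have : (f x <= m + (L x.1).+1)%N.
    rewrite /f task_start_unit Sm -natrD natrK; case: (x.2) => //; lia.
  have : f x = m \/ f x = (m + (L x.1).+1)%N.
    by rewrite /f task_start_unit Sm -natrD natrK; case: (x.2); [right|left]; lia.
  have := s_sorted ((s^-1)%g x.1) ko (ltnW Dx); rewrite permKV; lia.
(* A real start below [t] lies in an occupied unit slot, so the first task would overlap the task in
   that slot. *)
rewrite leNgt; apply/negP => St.
have /occ[x Dx xS] : (Num.truncn (S (s ko)) < t)%N by rewrite truncn_lt_nat.
apply: (first x Dx); rewrite task_len_unit xS; apply/overlap1P.
by have := truncn_itv S0; rewrite -natr1 => /andP[? ?]; apply/andP; split; lra.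
Qed.

Lemma algorithm1_approx (S : 'I_n -> R) : algorithm1_output I S ->
  exists2 opt : R, is_min_total_completion I opt &
    total_completion I S <= 3 / 2 * opt.
Proof.
move=> Sout; have [N Ninj Nmin] := unit_opt_exists (algorithm1_feasible Sout).
eexists; first exact: Nmin.
case: Sout => s [s_sorted S_least].
have S_le k : S (s k) <= (k.*2)%:R.
  have [m [-> mk _]] := algorithm1_unit_start s_sorted S_least k.
  by rewrite ler_nat.
have sumS : \sum_(j < n) S j <= (n * n.-1)%:R.
  rewrite (reindex_inj (@perm_inj _ s)) /=.
  apply: le_trans (ler_sum _ (fun k _ => S_le k)) _.
  rewrite -natr_sum ler_nat.
  have -> : (\sum_(k < n) k.*2 = n * n.-1)%N => //.
  rewrite -(big_mkord xpredT double).
  elim: (n) => [|m IHm]; first by rewrite big_geq.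
  rewrite big_nat_recr //= IHm; case: (m) => [|m'] /=; nia.
have := slot_sum_ge Ninj; rewrite big_split /= -!mul2n -(ler_nat R).
under eq_bigr do rewrite -mul2n.
rewrite -big_distrr /= natrD !natrM !total_completion_slot -natr_sum.
have : (n * n.-1)%:R <= n%:R * n%:R :> R by rewrite -natrM ler_nat; nia.
set A := (\sum_(j < n) N j)%:R; set B := (\sum_(j < n) _)%:R.
(* The optimum is [A + B] and the algorithm yields at most [n^2 + B]. The slot bound reads
   [n^2 <= A + B/2], so [n^2 + B <= A + 3/2 B <= 3/2 (A + B)]. *)
have : 0 <= A :> R by exact: ler0n.
lra.
Qed.
End Approximation.

(** * Running time *)

Section RunningTime.
Local Open Scope nat_scope.

(* [(x, p, o, q)]: a scheduled task occupies [x, x + p], and a task of the job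
   under consideration starts [o] after its candidate time and has length
   [q]. *)
Definition conflict := (nat * nat * nat * nat)%type.

Definition blocked (t : nat) (c : conflict) : bool :=
  let: (x, p, o, q) := c in [&& 0 < p, 0 < q, x < t + o + q & t + o < x + p].

(** The candidate time at which the conflict ends; the truncated subtraction is exact whenever the
    conflict blocks some time. *)
Definition release (c : conflict) : nat :=
  let: (x, p, o, q) := c in x + p - o.

Definition bump (t : nat) (c : conflict) : nat :=
  if blocked t c then release c else t.

Definition pass (cs : seq conflict) (t : nat) : nat := foldl bump t cs.

Lemma blocked_release t c : blocked t c -> t < release c.
Proof. by case: c => [[[x p] o] q] /=; lia. Qed.

Lemma bump_ge t c : t <= bump t c.
Proof. by rewrite /bump; case: ifP => // /blocked_release/ltnW. Qed.

Lemma pass_ge cs t : t <= pass cs t.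
Proof.
elim: cs t => //= c cs IHcs t; exact: leq_trans (bump_ge t c) (IHcs _).
Qed.

(** Termination measure: candidate times only grow, so a conflict once released stays released. *)
Definition pending (cs : seq conflict) (t : nat) : nat :=
  count (fun c => t < release c) cs.

Lemma pending_mono cs t u : t <= u -> pending cs u <= pending cs t.
Proof. by move=> tu; apply: sub_count => c /=; apply: leq_ltn_trans. Qed.

Lemma pending_lt cs t c : c \in cs -> blocked t c ->
  pending cs (release c) < pending cs t.
Proof.
move=> + /blocked_release tc; elim: cs => //= c' cs IHcs.
rewrite inE => /predU1P[<-|/IHcs].
  by rewrite ltnn tc add0n add1n ltnS; apply/pending_mono/ltnW.
rewrite -/(pending cs t) -/(pending cs (release c)); case: ltnP => ?; case: ltnP => ?; lia.
Qed.

(** The scanned list [cs'] is separated from [cs] so that the induction shortens the scan while the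
    measure keeps counting all conflicts. *)
Lemma pass_progress cs cs' t : {subset cs' <= cs} ->
  (pass cs' t = t /\ ~~ has (blocked t) cs') \/
  (pending cs (pass cs' t) < pending cs t).
Proof.
elim: cs' t => [|c cs' IHcs'] t sub /=; first by left.
have sub' : {subset cs' <= cs} by move=> d dcs; apply: sub; rewrite inE dcs orbT.
rewrite /bump; case: ifP => [tc|_] /=; last exact: IHcs'.
right; apply: leq_ltn_trans (pending_mono _ (pass_ge cs' _)) _.
by apply: pending_lt tc; apply: sub; rewrite inE eqxx.
Qed.

Lemma iter_pass_free cs m : size cs <= m ->
  ~~ has (blocked (iter m (pass cs) 0)) cs.
Proof.
move=> sz_le; set t := iter m (pass cs) 0.
(* Until the candidate is free, each pass releases at least one conflict. After [size cs] passes
   none is pending, and a blocking conflict is always pending. *)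
have : ~~ has (blocked t) cs \/ pending cs t + m <= size cs.
  rewrite {}/t; elim: m {sz_le} => [|m IHm] /=; first by right; rewrite addn0 count_size.
  set t := iter m _ _ in IHm *.
  have [[-> ?]|lt_pending] := @pass_progress cs cs t (fun _ => id); first by left.
  case: IHm => [t_free|]; last by right; lia.
  have [[-> ?]|] := @pass_progress cs cs t (fun _ => id); first by left.
  suff -> : pass cs t = t by rewrite ltnn.
  move: t_free; rewrite /pass; elim: (cs) => //= c cs' IH /norP[/negbTE tc /IH].
  by rewrite /bump tc.
case=> // pending_le; apply/hasPn => c ccs; apply/negP => tc.
by have := pending_lt ccs tc; lia.
Qed.

Section RealTimes.
Variable R : realType.
Local Open Scope ring_scope.
(** Real times are needed because Algorithm 1 minimizes over all real starting times. *)
Definition blocked_at (u : R) (c : conflict) : Prop :=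
  let: (x, p, o, q) := c in overlap x%:R p%:R (u + o%:R) q%:R.

Lemma blocked_at_nat t c : blocked_at t%:R c <-> blocked t c.
Proof.
case: c => [[[x p] o] q] /=; rewrite -natrD; split.
  by case/overlapP; rewrite -!natrD !ltr_nat ?ltr0n => *; apply/and4P.
by case/and4P=> *; apply/overlapP; rewrite -!natrD !ltr_nat ?ltr0n.
Qed.

(** A conflict that blocks [t] also blocks every real time from [t] up to its release, so no
    admissible time is skipped by a jump. *)
Lemma pass_blocked (cs cs' : seq conflict) t : {subset cs' <= cs} ->
  (forall u, 0 <= u < t%:R -> exists2 c, c \in cs & blocked_at u c) ->
  (forall u, 0 <= u < (pass cs' t)%:R -> exists2 c, c \in cs & blocked_at u c).
Proof.
elim: cs' t => //= c cs' IHcs' t sub t_blocked.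
have sub' : {subset cs' <= cs} by move=> d dcs; apply: sub; rewrite inE dcs orbT.
apply: IHcs' sub' _ => u /andP[u0]; rewrite /bump; case: ifP => [tc|_ ut]; last first.
  by apply: t_blocked; rewrite u0.
have [tu uc|ut _] := lerP t%:R u; last by apply: t_blocked; rewrite u0.
exists c; first by apply: sub; rewrite inE eqxx.
have := blocked_release tc; case: c tc uc {sub} => [[[x p] o] q] /=.
case/and4P => p0 q0 xq xp; rewrite natrB ?natrD; last by lia.
move=> uc _; apply/overlapP.
move: p0 q0 xq xp; rewrite -!(ltr_nat R) !natrD => p0 q0 xq xp; split => //; lra.
Qed.

Lemma iter_pass_blocked cs m u : 0 <= u < (iter m (pass cs) 0%N)%:R ->
  exists2 c, c \in cs & blocked_at u c.
Proof.
elim: m u => [|m IHm] u; first by move=> /=; lra.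
exact: pass_blocked IHm u.
Qed.

End RealTimes.

(** * Total-correctness rules with step counts *)

Definition runs (c : com) (st : state) (Q : nat -> state -> Prop) : Prop :=
  exists t st', exec c st t st' /\ Q t st'.

Definition set_reg (st : state) (x v : nat) : state :=
  State (update (register st) x v) (memory st).

Lemma runs_mono c st (Q Q' : nat -> state -> Prop) :
  runs c st Q -> (forall t st', Q t st' -> Q' t st') -> runs c st Q'.
Proof. by move=> [t [st' [ex /[swap] QQ' /QQ' Qst']]]; exists t, st'. Qed.

Lemma runs_Skip st (Q : nat -> state -> Prop) : Q 1 st -> runs Skip st Q.
Proof. by move=> Qst; exists 1, st; split=> //; constructor. Qed.

Lemma runs_SetReg x e st (Q : nat -> state -> Prop) :
  Q (eval_cost e).+1 (set_reg st x (eval st e)) -> runs (SetReg x e) st Q.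
Proof. by move=> Qst; do 2![eexists]; split; last exact: Qst; constructor. Qed.

Lemma runs_SetMem e1 e2 st (Q : nat -> state -> Prop) :
  Q (eval_cost e1 + eval_cost e2).+1
    (State (register st) (update (memory st) (eval st e1) (eval st e2))) ->
  runs (SetMem e1 e2) st Q.
Proof. by move=> Qst; do 2![eexists]; split; last exact: Qst; constructor. Qed.

Lemma runs_Seq c1 c2 st (Q : nat -> state -> Prop) :
  runs c1 st (fun t1 st1 => runs c2 st1 (fun t2 st2 => Q (t1 + t2) st2)) ->
  runs (Seq c1 c2) st Q.
Proof.
move=> [t1 [st1 [ex1 [t2 [st2 [ex2 Qst2]]]]]].
by exists (t1 + t2), st2; split=> //; apply: exec_Seq ex1 ex2.
Qed.

Lemma runs_IfLe e1 e2 c1 c2 st (Q : nat -> state -> Prop) :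
  runs (if eval st e1 <= eval st e2 then c1 else c2) st
    (fun t st' => Q (eval_cost e1 + eval_cost e2 + t).+1 st') ->
  runs (IfLe e1 e2 c1 c2) st Q.
Proof.
case: leqP => e12 [t [st' [ex Qst']]]; do 2![eexists]; split; try exact: Qst'.
  exact: exec_IfLe_true.
exact: exec_IfLe_false.
Qed.

Definition For (i lim : nat) (body : com) : com :=
  Seq (SetReg i (Const 0))
      (WhileLe (Add (Reg i) (Const 1)) (Reg lim)
         (Seq body (SetReg i (Add (Reg i) (Const 1))))).

(** An iteration costs 5 steps for the test and 4 for the increment besides the body; the
    initialization and the last test cost 2 + 5. *)
Lemma runs_For i lim body N T (Inv : nat -> state -> Prop) st :
  Inv 0 (set_reg st i 0) ->
  (forall k st', Inv k st' -> register st' i = k /\ register st' lim = N) ->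
  (forall k st', k < N -> Inv k st' -> runs body st' (fun t st2 =>
     [/\ t <= T, register st2 i = k & Inv k.+1 (set_reg st2 i k.+1)])) ->
  runs (For i lim body) st (fun t st' => t <= N * (T + 9) + 7 /\ Inv N st').
Proof.
move=> Inv0 Invreg Invstep; apply/runs_Seq/runs_SetReg => /=.
suff loop m k st' : k + m = N -> Inv k st' ->
    runs (WhileLe (Add (Reg i) (Const 1)) (Reg lim)
            (Seq body (SetReg i (Add (Reg i) (Const 1))))) st'
         (fun t st2 => t <= m * (T + 9) + 5 /\ Inv N st2).
  by apply: runs_mono (loop N 0 _ _ Inv0) _ => // t st' [? ?]; split=> //; lia.
elim: m k st' => [|m IHm] k st' kmN Ik; have [ri rlim] := Invreg _ _ Ik.
  exists 5, st'; split; last by rewrite -kmN addn0.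
  by apply: (@exec_WhileLe_false _ (Add _ _) (Reg _)); rewrite /= ri rlim; lia.
have [t1 [st1 [ex1 [t1T ri1 Ik1]]]] := Invstep k st' ltac:(lia) Ik.
have [t2 [st2 [ex2 [t2T IN]]]] := IHm k.+1 _ ltac:(lia) Ik1.
exists (3 + 1 + (t1 + 4) + t2).+1, st2; split; last by split=> //; lia.
apply: (@exec_WhileLe_true _ (set_reg st1 i k.+1) _ (Add _ _) (Reg _)) => //.
  by rewrite /= ri rlim; lia.
apply: exec_Seq ex1 _.
by have := @exec_SetReg st1 i (Add (Reg i) (Const 1)); rewrite /= ri1 (addn1 k).
Qed.

Definition frame (rs : seq nat) (st st' : state) : Prop :=
  memory st' = memory st /\
  forall x, x \notin rs -> register st' x = register st x.

Lemma frame_trans rs st1 st2 st3 :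
  frame rs st1 st2 -> frame rs st2 st3 -> frame rs st1 st3.
Proof.
by move=> [m12 r12] [m23 r23]; split=> [|x xrs]; rewrite ?m23 // r23 ?r12.
Qed.

Lemma frame_sub rs rs' st st' :
  {subset rs <= rs'} -> frame rs st st' -> frame rs' st st'.
Proof.
by move=> sub [m r]; split=> // x xrs'; apply: r; apply: contra xrs' => /sub.
Qed.

Lemma frame_set_reg rs st x v : x \in rs -> frame rs st (set_reg st x v).
Proof.
move=> xrs; split=> // y yrs; rewrite /= /update.
by case: eqP yrs => // ->; rewrite xrs.
Qed.

(* Register 6 holds the candidate starting time. *)
Definition Bump (x p : nat) (o : expr) (q : nat) : com :=
  IfLe (Const 1) (Reg p)
 (IfLe (Const 1) (Reg q)
 (IfLe (Add (Reg x) (Const 1)) (Add (Add (Reg 6) o) (Reg q))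
 (IfLe (Add (Add (Reg 6) o) (Const 1)) (Add (Reg x) (Reg p))
    (SetReg 6 (Defs.Sub (Add (Reg x) (Reg p)) o)) Skip) Skip) Skip) Skip.

(** The offset is a constant or a register, so four tests and an assignment cost at most 3 + 3 + 9 +
    9 + 6 steps. Strict inequalities are tested by adding one on the left. *)
Lemma runs_Bump x p o q st : eval_cost o <= 1 ->
  runs (Bump x p o q) st (fun t st' => [/\ t <= 30, frame [:: 6] st st' &
    register st' 6 = bump (register st 6)
                       (register st x, register st p, eval st o, register st q)]).
Proof.
move=> o1; rewrite /bump /blocked /release.
apply: runs_IfLe => /=; case: ifP => p0; last by apply: runs_Skip.
apply: runs_IfLe => /=; case: ifP => q0; last by apply: runs_Skip; split=> //; lia.
apply: runs_IfLe => /=; rewrite addn1; case: ifP => xq /=; last first.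
  by apply: runs_Skip; split=> //; lia.
apply: runs_IfLe => /=; rewrite addn1; case: ifP => xp /=; last first.
  by apply: runs_Skip; split=> //; lia.
by apply: runs_SetReg; split; [rewrite /=; lia|exact: frame_set_reg|].
Qed.

Definition job_conflicts (a b x d d' : nat) : seq conflict :=
  [:: (x, a, 0, a); (x + a + d, b, 0, a);
      (x, a, a + d', b); (x + a + d, b, a + d', b)].

(* Memory: [n] delays, [n] starting times, then the jobs in sorted order. *)
Definition conflicts (n a b : nat) (M : nat -> nat) (k : nat) : seq conflict :=
  flatten [seq job_conflicts a b (M (n + M (n + n + i))) (M (M (n + n + i)))
                             (M (M (n + n + k))) | i <- iota 0 k].

Lemma size_conflicts n a b M k : size (conflicts n a b M k) = k * 4.
Proof.
rewrite size_flatten /shape -map_comp (eq_map (g := fun=> 4)) //.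
by rewrite -[in RHS](size_iota 0 k); elim: (iota 0 k) => //= ? ? ->; rewrite mulSn.
Qed.

(* Registers: 3 and 4 are the positions of the job under consideration and of
   an earlier job, 5 and 9 these jobs, 10 and 11 the starts of the two tasks of
   the earlier job, 12 the offset of the second task of the other one. *)
Definition Pass : com :=
  For 4 3
   (Seq (SetReg 9 (Defs.Mem (Add (Add (Reg 0) (Reg 0)) (Reg 4))))
   (Seq (SetReg 10 (Defs.Mem (Add (Reg 0) (Reg 9))))
   (Seq (SetReg 11 (Add (Add (Reg 10) (Reg 1)) (Defs.Mem (Reg 9))))
   (Seq (SetReg 12 (Add (Reg 1) (Defs.Mem (Reg 5))))
   (Seq (Bump 10 1 (Const 0) 1)
   (Seq (Bump 11 2 (Const 0) 1)
   (Seq (Bump 10 1 (Reg 12) 2)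
        (Bump 11 2 (Reg 12) 2)))))))).

Lemma runs_Pass n a b k st :
  register st 0 = n -> register st 1 = a -> register st 2 = b ->
  register st 3 = k -> register st 5 = memory st (n + n + k) ->
  runs Pass st (fun t st' =>
    [/\ t <= k * 153 + 7, frame [:: 4; 6; 9; 10; 11; 12] st st' &
      register st' 6 = pass (conflicts n a b (memory st) k) (register st 6)]).
Proof.
move=> r0 r1 r2 r3 r5; set rs := [:: 4; _; _; _; _; _].
(* In [conflicts], [k] is both the number of earlier jobs and the position of the current job; [C m]
   fixes the latter and varies the former. *)
have [C CE] : exists C, C = fun m => flatten
    [seq job_conflicts a b (memory st (n + memory st (n + n + i)))
       (memory st (memory st (n + n + i))) (memory st (memory st (n + n + k)))
    | i <- iota 0 m].
  by eexists.
(* Four assignments cost 24 steps and four bumps at most 30 each. *)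
apply: runs_mono (@runs_For 4 3 _ k 144
  (fun m st' => [/\ frame rs st st', register st' 4 = m &
     register st' 6 = pass (C m) (register st 6)]) _ _ _ _) _; last first.
- by move=> t st' [t_le [fr _ r6]]; split; [lia| |rewrite r6 CE].
- move=> m st' mk [fr r4 r6].
  have [memE regE] := fr.
  apply/runs_Seq/runs_SetReg/runs_Seq/runs_SetReg/runs_Seq/runs_SetReg/runs_Seq/runs_SetReg.
  rewrite /= /update /= !memE r4 !regE // r0 r1 r5.
  set st1 := set_reg _ 12 _.
  have fr1 : frame rs st st1.
    by do 4![apply: frame_trans (frame_set_reg _ _ _); last by []].
  have Cm : C m.+1 = C m ++ job_conflicts a b (memory st (n + memory st (n + n + m)))
      (memory st (memory st (n + n + m))) (memory st (memory st (n + n + k))).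
    by rewrite CE -addn1 iotaD map_cat flatten_cat.
  apply: runs_Seq; apply: runs_mono (@runs_Bump 10 1 (Const 0) 1 st1 isT) _.
  move=> t1 st2 [t1_le fr2 r2_6].
  apply: runs_Seq; apply: runs_mono (@runs_Bump 11 2 (Const 0) 1 st2 isT) _.
  move=> t2 st3 [t2_le fr3 r3_6].
  apply: runs_Seq; apply: runs_mono (@runs_Bump 10 1 (Reg 12) 2 st3 isT) _.
  move=> t3 st4 [t3_le fr4 r4_6].
  apply: runs_mono (@runs_Bump 11 2 (Reg 12) 2 st4 isT) _.
  move=> t4 st5 [t4_le fr5 r5_6].
  have fr13 := frame_trans fr2 fr3; have fr14 := frame_trans fr13 fr4.
  have fr15 := frame_trans fr14 fr5.
  have fr5' : frame rs st st5.
    by apply: frame_trans fr1 (frame_sub _ fr15) => x; rewrite inE => /eqP->.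
  split; [lia|by rewrite fr15.2 //=|split=> //].
    exact: frame_trans fr5' (frame_set_reg _ _ _).
  rewrite Cm /pass foldl_cat -/(pass _ _) /=.
  rewrite r5_6 /= (fr14.2 11) // (fr14.2 12) // (fr14.2 2) //.
  rewrite r4_6 /= (fr13.2 10) // (fr13.2 12) // (fr13.2 1) // (fr13.2 2) //.
  rewrite r3_6 /= (fr2.2 11) // (fr2.2 1) // (fr2.2 2) //.
  rewrite r2_6 /= /update /= (regE 1) // r1 (regE 2) // r2 r6.
  by [].
- move=> m st' [fr r4 r6]; split=> //; have [_ ->] := fr => //.
by split=> //; [exact: frame_set_reg|rewrite CE].
Qed.

(** Register 8 holds [4n], the number of passes made for every job: each earlier job causes four
    conflicts, so this many passes suffice. *)
Definition Schedule : com :=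
  Seq (SetReg 8 (Add (Add (Reg 0) (Reg 0)) (Add (Reg 0) (Reg 0))))
  (For 3 0
   (Seq (SetReg 5 (Defs.Mem (Add (Add (Reg 0) (Reg 0)) (Reg 3))))
   (Seq (SetReg 6 (Const 0))
   (Seq (For 7 8 Pass)
        (SetMem (Add (Reg 0) (Reg 5)) (Reg 6)))))).

Lemma runs_passes n a b k st :
  register st 0 = n -> register st 1 = a -> register st 2 = b ->
  register st 3 = k -> register st 5 = memory st (n + n + k) ->
  register st 8 = n * 4 -> k <= n ->
  runs (For 7 8 Pass) st (fun t st' =>
    [/\ t <= n * 4 * (n * 153 + 16) + 7,
        frame [:: 7; 4; 6; 9; 10; 11; 12] st st' &
        register st' 6 =
          iter (n * 4) (pass (conflicts n a b (memory st) k)) (register st 6)]).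
Proof.
move=> r0 r1 r2 r3 r5 r8 kn; set rs := [:: 7; _; _; _; _; _; _].
apply: runs_mono (@runs_For 7 8 _ (n * 4) (n * 153 + 7)
  (fun m st' => [/\ frame rs st st', register st' 7 = m &
     register st' 6 =
       iter m (pass (conflicts n a b (memory st) k)) (register st 6)]) _ _ _ _) _.
- by split=> //; exact: frame_set_reg.
- by move=> m st' [[_ regE] r7 _]; rewrite r7 regE.
- move=> m st' mn [fr r7 r6]; have [memE regE] := fr.
  have := @runs_Pass n a b k st'.
  rewrite memE (regE 0) ?(regE 1) ?(regE 2) ?(regE 3) ?(regE 5) //.
  move=> /(_ r0 r1 r2 r3 r5) pass_runs.
  apply: runs_mono pass_runs _ => t st2 [t_le fr2 r6']; split.
  + by apply: leq_trans t_le _; rewrite leq_add2r leq_mul2r kn orbT.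
  + by rewrite fr2.2.
  have fr3 : frame rs st st2.
    by apply: frame_trans fr (frame_sub _ fr2) => x xrs; rewrite inE xrs orbT.
  split=> //; first exact: frame_trans fr3 (frame_set_reg _ _ _).
  by rewrite iterS -r6 -r6'.
by move=> t st' [t_le [fr _ r6]]; split=> //; lia.
Qed.

Section Schedule.
Variables (n a b : nat) (delays order : nat -> nat).
Hypothesis order_lt : forall i, i < n -> order i < n.
Hypothesis order_inj : forall i k, i < n -> k < n -> order i = order k -> i = k.

Definition scheduled (k : nat) (M : nat -> nat) : Prop :=
  [/\ forall j, j < n -> M j = delays j,
      forall i, i < n -> M (n + n + i) = order i &
      forall i, i < k ->
        M (n + order i) = iter (n * 4) (pass (conflicts n a b M i)) 0].

Lemma scheduledS k M : k < n -> scheduled k M ->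
  scheduled k.+1 (update M (n + M (n + n + k))
    (iter (n * 4) (pass (conflicts n a b M k)) 0)).
Proof.
move=> kn [M_delays M_order M_start]; rewrite M_order //; set M' := update M _ _.
have M'E x : x != n + order k -> M' x = M x by rewrite /M' /update => /negbTE->.
have M'_order i : i < n -> M' (n + n + i) = order i.
  by move=> i_n; rewrite M'E ?M_order //; have := order_lt kn; lia.
have M'_delays j : j < n -> M' j = delays j.
  by move=> jn; rewrite M'E ?M_delays //; lia.
(* The conflicts at position [i] read only delays, the order and the starts at positions below [i];
   by injectivity of [order], none of these is the cell just written. *)
have confE i : i <= k -> conflicts n a b M' i = conflicts n a b M i.
  move=> ik; congr flatten; apply/eq_in_map => l; rewrite mem_iota => /= li.
  have [ln i_n] : l < n /\ i < n by lia.
  rewrite !M'_order // !M_order //.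
  rewrite (M'_delays (order l)) ?(M'_delays (order i)) ?order_lt //.
  rewrite (M_delays (order l)) ?(M_delays (order i)) ?order_lt //.
  rewrite M'E //; apply/eqP => /addnI/order_inj; lia.
split=> // i; rewrite ltnS => ik; rewrite confE //.
have [->|ne] := eqVneq i k; first by rewrite /M' /update eqxx.
rewrite M'E ?M_start //; first lia.
by apply: contra ne => /eqP/addnI/order_inj->; lia.
Qed.

Lemma runs_Schedule st :
  register st 0 = n -> register st 1 = a -> register st 2 = b ->
  scheduled 0 (memory st) ->
  runs Schedule st (fun t st' =>
    t <= n * (n * 4 * (n * 153 + 16) + 30) + 15 /\ scheduled n (memory st')).
Proof.
move=> r0 r1 r2 M0; apply/runs_Seq/runs_SetReg => /=.
apply: runs_mono (@runs_For 3 0 _ n (n * 4 * (n * 153 + 16) + 21)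
  (fun k st' => [/\ scheduled k (memory st'), register st' 3 = k,
     register st' 0 = n, register st' 1 = a &
     register st' 2 = b /\ register st' 8 = n * 4]) _ _ _ _) _.
- by split=> //; split=> //; rewrite /= /update /= r0; lia.
- by move=> k st' [].
- move=> k st1 kn [Mk s3 s0 s1 [s2 s8]].
  apply/runs_Seq/runs_SetReg/runs_Seq/runs_SetReg/runs_Seq.
  set st2 := set_reg _ 6 _.
  have r5 : register st2 5 = memory st2 (n + n + k) by rewrite /= /update /= s0 s3.
  have := @runs_passes n a b k st2 s0 s1 s2 s3 r5 s8 (ltnW kn).
  move=> passes_run; apply: runs_mono passes_run _.
  move=> t st3 [t_le [memE regE] r6]; apply: runs_SetMem.
  have r3_0 : register st3 0 = n by rewrite regE.
  have r3_5 : register st3 5 = memory st1 (n + n + k) by rewrite regE.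
  rewrite /= r3_0 r3_5 r6 memE; split; [lia|by rewrite regE|].
  by split; rewrite /= /update /= ?regE //; exact: scheduledS.
by move=> t st' [t_le [Mn _ _ _ _]]; split=> //; lia.
Qed.
End Schedule.

(** * Sorting the jobs by computing ranks *)

Section Rank.
Variables (n : nat) (d : nat -> nat).

(** Breaking ties by index makes this a strict total order, so that ranks are distinct. *)
Definition precedes (i j : nat) : bool :=
  (d i < d j) || (d i == d j) && (i < j).

Definition rank (j : nat) : nat := \sum_(0 <= i < n) precedes i j.

(** By transitivity, whatever precedes [i] precedes [j], and [i] itself is counted only for [j]. *)
Lemma rank_mono i j : i < n -> precedes i j -> rank i < rank j.
Proof.
move=> i_n ij; rewrite /rank !big_mkord.
rewrite (bigD1 (Ordinal i_n)) // [X in _ < X](bigD1 (Ordinal i_n)) //= ij.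
have -> : precedes i i = false by rewrite /precedes; lia.
rewrite add0n add1n ltnS; apply: leq_sum => l _.
have : precedes l i ==> precedes l j by move: ij; rewrite /precedes; lia.
by case: (precedes l i); case: (precedes l j).
Qed.

Lemma rank_lt j : j < n -> rank j < n.
Proof.
move=> jn; rewrite /rank big_mkord (bigD1 (Ordinal jn)) //=.
have -> : precedes j j = false by rewrite /precedes; lia.
rewrite add0n -[X in _ < X]card_ord (cardD1 (Ordinal jn)) inE add1n ltnS -sum1_card.
rewrite big_mkcond [X in _ <= X]big_mkcond; apply: leq_sum => l _.
by rewrite !inE; case: eqP => //= _; exact: leq_b1.
Qed.

Lemma rank_inj i j : i < n -> j < n -> rank i = rank j -> i = j.
Proof.
move=> i_n jn eq_rank; have [//|ne] := eqVneq i j.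
have : precedes i j || precedes j i by rewrite /precedes; lia.
by case/orP => /rank_mono; rewrite eq_rank ltnn => /(_ ltac:(assumption)).
Qed.

Definition Rank : com :=
  For 4 0
   (IfLe (Add (Defs.Mem (Reg 4)) (Const 1)) (Defs.Mem (Reg 3))
      (SetReg 5 (Add (Reg 5) (Const 1)))
   (IfLe (Defs.Mem (Reg 4)) (Defs.Mem (Reg 3))
      (IfLe (Add (Reg 4) (Const 1)) (Reg 3)
         (SetReg 5 (Add (Reg 5) (Const 1))) Skip) Skip)).

Definition Sort : com :=
  For 3 0
   (Seq (SetReg 5 (Const 0))
   (Seq Rank
        (SetMem (Add (Add (Reg 0) (Reg 0)) (Reg 5)) (Reg 3)))).

Lemma runs_Rank j st :
  register st 0 = n -> register st 3 = j -> register st 5 = 0 -> j < n ->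
  (forall i, i < n -> memory st i = d i) ->
  runs Rank st
   (fun t st' => [/\ t <= n * 40 + 7, frame [:: 4; 5] st st' &
      register st' 5 = rank j]).
Proof.
move=> r0 r3 r5 jn Md.
apply: runs_mono (@runs_For 4 0 _ n 31
  (fun k st' => [/\ frame [:: 4; 5] st st', register st' 4 = k &
     register st' 5 = \sum_(0 <= i < k) precedes i j]) _ _ _ _) _.
- by split=> //; [exact: frame_set_reg | rewrite big_geq].
- by move=> k st' [[_ regE] r4 _]; rewrite r4 regE.
- move=> k st' kn [fr r4 r5']; have [memE regE] := fr.
  apply: (@runs_mono _ _ (fun t st2 => [/\ t <= 31, frame [:: 5] st' st2 &
      register st2 5 = register st' 5 + precedes k j])); last first.
    move=> t st2 [t_le fr2 s5]; split=> //; first by rewrite fr2.2.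
    have fr3 : frame [:: 4; 5] st st2.
      apply: frame_trans fr (frame_sub _ fr2) => x.
      by rewrite !inE => ->; rewrite orbT.
    split=> //; first exact: frame_trans fr3 (frame_set_reg _ _ _).
    by rewrite big_nat_recr //= -r5'.
  apply: runs_IfLe; rewrite /= memE r4 regE // r3 !Md // addn1 /precedes.
  case: ltnP => [lt_d|ge_d].
    by apply: runs_SetReg; split=> //; exact: frame_set_reg.
  apply: runs_IfLe; rewrite /= memE r4 regE // r3 !Md //.
  rewrite [d k == _]eqn_leq ge_d andbT; case: ifP => le_d; last first.
    by apply: runs_Skip; split=> //; rewrite addn0.
  apply: runs_IfLe; rewrite /= r4 regE // r3 addn1 /=; case: ifP => lt_kj.
    by apply: runs_SetReg; split=> //; exact: frame_set_reg.
  by apply: runs_Skip; split=> //; rewrite addn0.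
by move=> t st' [t_le [fr _ s5]].
Qed.

Lemma runs_Sort st :
  register st 0 = n -> (forall i, i < n -> memory st i = d i) ->
  runs Sort st (fun t st' =>
   [/\ t <= n * (n * 40 + 30) + 7,
       (forall x, x < 3 -> register st' x = register st x),
       (forall j, j < n -> memory st' j = d j) &
       (forall j, j < n -> memory st' (n + n + rank j) = j)]).
Proof.
move=> r0 Md.
apply: runs_mono (@runs_For 3 0 _ n (n * 40 + 21)
  (fun k st' => [/\ (forall x, x < 3 -> register st' x = register st x),
      register st' 3 = k,
      (forall j, j < n -> memory st' j = d j) &
      (forall j, j < k -> memory st' (n + n + rank j) = j)]) _ _ _ _) _.
- by split=> // x x3; rewrite /= /update; case: eqP x3 => // ->.
- by move=> k st' [regE r3 _ _]; rewrite r3 regE.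
- move=> k st1 kn [regE r3 Md1 Mrank].
  apply/runs_Seq/runs_SetReg/runs_Seq => /=; set st2 := set_reg _ _ _.
  have rank_run : runs _ st2 _ :=
    @runs_Rank k st2 (etrans (regE 0 isT) r0) r3 erefl kn Md1.
  apply: runs_mono rank_run _ => t st3 [t_le [memE regE3] s5].
  apply: runs_SetMem.
  have s3_0 : register st3 0 = n by rewrite regE3 //= /update /= regE.
  have s3_3 : register st3 3 = k by rewrite regE3.
  rewrite /= s3_0 s3_3 s5 memE; split; [lia|by []|split=> //=].
  + move=> x x3; rewrite /update ifN; last by apply/eqP => x_3; rewrite x_3 in x3.
    rewrite regE3; last by rewrite !inE; lia.
    by rewrite /= /update ifN ?regE //; lia.
  + by move=> j jn; rewrite /update ifN ?Md1 //; lia.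
  move=> j; rewrite ltnS => jk; rewrite /update eqn_add2l.
  have [->|ne] := eqVneq j k; first by rewrite eqxx.
  rewrite ifN; first by apply: Mrank; lia.
  by apply: contra ne => /eqP/rank_inj->; lia.
by move=> t st' [t_le [regE _ Md' Mrank]]; split=> //; lia.
Qed.
End Rank.

(** * Correctness and running time of the whole program *)

Section Correctness.
Variables (R : realType) (n a b : nat) (L : 'I_n -> nat).
Local Open Scope ring_scope.

Lemma can_start_conflicts (M : nat -> nat) (s : {perm 'I_n}) (k : 'I_n) (u : R) :
  (forall j : 'I_n, M j = L j) ->
  (forall i : 'I_n, M (n + n + i)%N = s i) ->
  can_start (equal_len_instance a b L) (fun j => (M (n + j)%N)%:R)
    [pred j | ((s^-1)%g j < k)%N] (s k) u <->
  0 <= u /\ forall c, c \in conflicts n a b M k -> ~ blocked_at u c.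
Proof.
move=> ML Ms; split.
  move=> [u0 first second]; split=> // c /flatten_mapP[i].
  rewrite mem_iota => /andP[_ ik].
  have i_n : (i < n)%N := ltn_trans ik (ltn_ord k).
  have iD : ((s^-1)%g (s (Ordinal i_n)) < k)%N by rewrite permK.
  rewrite (Ms (Ordinal i_n)) (Ms k) !ML.
  rewrite !inE => /or4P[] /eqP->; rewrite /= ?addr0 ?natrD ?addrA.
  - exact: first (s (Ordinal i_n), false) iD.
  - exact: first (s (Ordinal i_n), true) iD.
  - exact: second (s (Ordinal i_n), false) iD.
  - exact: second (s (Ordinal i_n), true) iD.
move=> [u0 free].
have unblocked x c : ((s^-1)%g x < k)%N ->
    c \in job_conflicts a b (M (n + x)%N) (L x) (L (s k)) -> ~ blocked_at u c.
  move=> xk cx; apply: free; apply/flatten_mapP; exists ((s^-1)%g x : nat).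
    by rewrite mem_iota.
  by rewrite (Ms k) Ms permKV !ML.
split=> //.
  move=> [x []] /= xk.
    have := @unblocked x ((M (n + x) + a + L x)%N, b, 0%N, a) xk.
    by rewrite !inE eqxx ?orbT => /(_ isT); rewrite /= addr0 !natrD.
  have := @unblocked x (M (n + x)%N, a, 0%N, a) xk.
  by rewrite !inE eqxx ?orbT => /(_ isT); rewrite /= addr0.
move=> [x []] /= xk.
  have := @unblocked x ((M (n + x) + a + L x)%N, b, (a + L (s k))%N, b) xk.
  by rewrite !inE eqxx ?orbT => /(_ isT); rewrite /= !natrD !addrA.
have := @unblocked x (M (n + x)%N, a, (a + L (s k))%N, b) xk.
by rewrite !inE eqxx ?orbT => /(_ isT); rewrite /= !natrD !addrA.
Qed.

(** The iterated passes end at an admissible time by [iter_pass_free], and every smaller nonnegative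
    real time is blocked by [iter_pass_blocked]. *)
Lemma scheduled_output (delays : nat -> nat) (s : {perm 'I_n})
    (order : nat -> nat) (st : state) :
  (forall j : 'I_n, delays j = L j) -> (forall i : 'I_n, order i = s i) ->
  (forall i k : 'I_n, (i <= k)%N -> (L (s i) <= L (s k))%N) ->
  scheduled n a b delays order n (memory st) ->
  algorithm1_output (equal_len_instance a b L) (@output_schedule R n st).
Proof.
move=> delaysE orderE s_sorted [M_delays M_order M_start].
exists s; split=> // k; set M := memory st in M_delays M_order M_start.
have can_startE u := @can_start_conflicts M s k u
  (fun j => etrans (M_delays j (ltn_ord j)) (delaysE j))
  (fun i => etrans (M_order i (ltn_ord i)) (orderE i)).
have Sk : output_schedule R st (s k) =
    (iter (n * 4) (pass (conflicts n a b M k)) 0%N)%:R.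
  by rewrite /output_schedule -orderE -/M M_start.
have size_le : (size (conflicts n a b M k) <= n * 4)%N.
  by rewrite size_conflicts leq_mul2r ltnW.
rewrite Sk; split.
  apply/can_startE; split=> [|c c_in /blocked_at_nat c_blocks]; first exact: ler0n.
  by have /hasPn/(_ c c_in)/negP := iter_pass_free size_le.
move=> u /can_startE[u0 free]; rewrite leNgt; apply/negP => ut.
have [|c c_in c_blocks] := @iter_pass_blocked R (conflicts n a b M k) (n * 4) u.
  by rewrite u0.
exact: free c_in c_blocks.
Qed.

(** Every delay takes at least one digit; hence a step bound polynomial in [n] is polynomial in the
    input size. *)
Lemma input_size_ge : (n <= input_size a b L)%N.
Proof.
rewrite /input_size; apply: leq_trans (leq_addl _ _).
by rewrite -[X in (X <= _)%N]card_ord -sum1_card; exact: leq_sum.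
Qed.

End Correctness.

(** Ranks are distinct and below [n], so [rank] permutes the jobs; [s] is its inverse. *)
Lemma sorting_perm n (d : nat -> nat) : exists s : {perm 'I_n},
  (forall i k : 'I_n, i <= k -> d (s i) <= d (s k)) /\
  (forall k : 'I_n, rank n d (s k) = k).
Proof.
pose r (j : 'I_n) := Ordinal (rank_lt d (ltn_ord j)).
have r_inj : injective r.
  move=> i j /(congr1 val)/=.
  by move=> /(rank_inj (ltn_ord i) (ltn_ord j)) ij; apply/val_inj.
have rank_s k : rank n d ((perm r_inj)^-1%g k) = k.
  by have := congr1 val (permKV (perm r_inj) k); rewrite permE.
exists (perm r_inj)^-1%g; split=> // i k; apply: contraLR; rewrite -!ltnNge => lt_d.
rewrite -[k in k < i]rank_s -[i in _ < i]rank_s.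
by apply: rank_mono => //; rewrite /precedes lt_d.
Qed.

Lemma algorithm1_polytime (R : realType) : polytime_algorithm1 R.
Proof.
(* Sorting is quadratic in [n] and scheduling cubic with leading coefficient 4 * 153 = 612, so 1000
   is a generous constant. *)
exists (Seq Sort Schedule), (1000%:P * ('X + 1) ^+ 3)%R => n a b L.
pose d i := if insub i is Some j then L j else 0.
have dE (j : 'I_n) : d j = L j by rewrite /d valK.
have [s [s_sorted s_rank]] := sorting_perm n d.
pose order i := if insub i is Some k then s k : nat else 0.
have orderE (k : 'I_n) : order k = s k by rewrite /order valK.
suff [t [st [ex [t_le sched]]]] : runs (Seq Sort Schedule) (input_state a b L)
    (fun t st => t <= 1000 * n.+1 ^ 3 /\ scheduled n a b d order n (memory st)).
  exists t, st; split=> //; last first.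
    by apply: (scheduled_output _ dE orderE _ sched) => i k /s_sorted; rewrite !dE.
  apply: leq_trans t_le _; rewrite !hornerE !(natrME, natrDE, natn) addn1.
  by rewrite !leq_mul ?ltnS ?input_size_ge.
apply: runs_Seq; apply: runs_mono (@runs_Sort n d (input_state a b L) erefl _) _ => //.
move=> t1 st1 [t1_le regE st1_d st1_rank].
apply: runs_mono (@runs_Schedule n a b d order _ _ st1 _ _ _ _) _; rewrite ?regE //.
- by move=> i i_n; rewrite (orderE (Ordinal i_n)).
- move=> i k i_n k_n; rewrite (orderE (Ordinal i_n)) (orderE (Ordinal k_n)).
  by move=> /val_inj/perm_inj/(congr1 val).
- split=> // i i_n; rewrite (orderE (Ordinal i_n)) -[RHS]st1_rank //.
  by rewrite s_rank.
move=> t2 st2 [t2_le sched]; split=> //.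
apply: leq_trans (leq_add t1_le t2_le) _; rewrite !expnS expn0; nia.
Qed.

End RunningTime.

Theorem theorem6 (R : realType) :
  polytime_algorithm1 R /\
  (forall (n : nat) (L : 'I_n -> nat) (S : 'I_n -> R),
     let I := equal_len_instance 1 1 L in
     algorithm1_output I S ->
     feasible I S /\
     exists2 opt : R, is_min_total_completion I opt &
       total_completion I S <= 3 / 2 * opt).
Proof.
split; first exact: algorithm1_polytime.
move=> n L S I S_out; split; first exact: algorithm1_feasible S_out.
exact: algorithm1_approx S_out.
Qed.
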